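(* Let $E\subseteq\mathbb{R}^n$ and let $F$ denote the union of $E$ with every (affine) line in $\mathbb{R}^n$ that intersects $E$ in a set of Hausdorff dimension $1$. Then either $E=F$, or $$\dim_P(F)\le 2\dim_P(E)-1.$$
   Context: $\dim_P$ denotes packing dimension. *)

(* Defs.v *)
(* Distances are Euclidean: the library norm on matrices is the sup norm. *)
From HB Require Import structures.
From mathcomp Require Import all_boot all_order all_algebra.
From mathcomp Require Import all_classical all_reals all_analysis.

Set Implicit Arguments.
Unset Strict Implicit.
Unset Printing Implicit Defensive.

Import Order.TTheory GRing.Theory Num.Theory.

Local Open Scope classical_set_scope.
Local Open Scope ring_scope.

Section FractalDimensions.
Context {R : realType} {n : nat}.
Local Notation V := 'rV[R]_n.
Implicit Types (A E L : set V) (s delta : R).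

Definition edist (x y : V) : R :=
  Num.sqrt (\sum_(i < n) (x ord0 i - y ord0 i) ^+ 2).

Definition ecball (c : V) (r : R) : set V := [set x | edist c x <= r].

(* The maximum with 0 gives the empty set diameter 0. *)
Definition diam A : \bar R :=
  maxe 0%E (ereal_sup [set z | exists x y : V,
                          [/\ A x, A y & z = (edist x y)%:E]]).

(* At most countable families are indexed by a set [D : set nat], so that
   finite and empty families are allowed. Since [0 `^ 0 = 1], the measure
   below is the counting measure when [s = 0]. *)
Definition hausdorff_cover delta E (D : set nat) (U : nat -> set V) : Prop :=
  E `<=` \bigcup_(i in D) U i /\ forall i, D i -> (diam (U i) <= delta%:E)%E.

Definition hausdorff_premeasure s delta E : \bar R :=
  ereal_inf [set z | exists (D : set nat) (U : nat -> set V),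
    hausdorff_cover delta E D U /\ z = (\esum_(i in D) poweR (diam (U i)) s)%E].

Definition hausdorff_measure s E : \bar R :=
  ereal_sup [set hausdorff_premeasure s delta E | delta in [set d : R | 0 < d]].

Definition dimH E : \bar R :=
  ereal_inf [set s%:E | s in [set s : R | 0 <= s /\ hausdorff_measure s E = 0%E]].

Definition packing delta E (D : set nat) (c : nat -> V) (r : nat -> R) : Prop :=
  (forall i, D i -> E (c i) /\ 0 < r i <= delta) /\
  trivIset D (fun i => ecball (c i) (r i)).

Definition packing_premeasure_at s delta E : \bar R :=
  ereal_sup [set z | exists (D : set nat) (c : nat -> V) (r : nat -> R),
    packing delta E D c r /\ z = (\esum_(i in D) ((2 * r i) `^ s)%:E)%E].

Definition packing_premeasure s E : \bar R :=
  ereal_inf [set packing_premeasure_at s delta E | delta in [set d : R | 0 < d]].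

(* The premeasure is not countably subadditive, hence this second step. *)
Definition packing_measure s E : \bar R :=
  ereal_inf [set z | exists A : nat -> set V,
    E `<=` \bigcup_i A i /\ z = (\esum_(i in setT) packing_premeasure s (A i))%E].

Definition dimP E : \bar R :=
  ereal_inf [set s%:E | s in [set s : R | 0 <= s /\ packing_measure s E = 0%E]].

Definition is_line L : Prop :=
  exists a v : V, v != 0 /\ L = [set a + t *: v | t in [set: R]].

Definition line_extension E : set V :=
  E `|` \bigcup_(L in [set L | is_line L /\ dimH (E `&` L) = 1%E]) L.

End FractalDimensions.

(* Main.v *)
(** Fix [s > dimP E] and [tau < 1]. [E] is a countable union of bounded sets [A]
    with packing numbers [O(d^-s)], and every line [L] with [dimH (E `&` L) = 1]
    meets one of these sets so that covering [A `&` L] by [rho]-balls takes at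
    least [c * rho^-tau] of them, even after a small ball is removed. Take a
    bounded set of points [x] on lines with common [A] and [c], a [d]-separated
    family of [N] of them, and a [rho]-net of [A] with [rho] a small multiple of
    [d]. The line of each [x] passes near at least [c^2 rho^(-2 tau)] pairs of
    net points at mutual distance bounded below; conversely such a pair
    determines the line up to [O(rho)] and so serves only [O(1/rho)] of the
    points [x]. As there are [O(rho^(-2s))] pairs, [N = O(d^-(2s + 1 - 2 tau))].
    Let [tau] tend to 1 and [s] to [dimP E]. *)
From Pilot Require Import Defs.
From HB Require Import structures.
From mathcomp Require Import all_boot all_order all_algebra.
From mathcomp Require Import all_classical all_reals all_analysis.
From mathcomp Require Import finmap zify ring lra.
(* MathComp-Analysis has another [edist]. *)
Import Pilot.Defs.

Set Implicit Arguments.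
Unset Strict Implicit.
Unset Printing Implicit Defensive.

Import Order.TTheory GRing.Theory Num.Theory.
Import numFieldNormedType.Exports.

Local Open Scope classical_set_scope.
Local Open Scope ring_scope.

(** * The Euclidean norm and distance *)

Section EuclideanDistance.
Context {R : realType} {n : nat}.
Implicit Types (u v x y z : 'rV[R]_n).

(** Cauchy-Schwarz by Lagrange's identity: twice the difference of the two sides is the sum of the
    squares of all [a i * b j - a j * b i]. *)
Lemma sum_mul_sqr_le (a b : 'I_n -> R) :
  (\sum_i a i * b i) ^+ 2 <= (\sum_i a i ^+ 2) * (\sum_i b i ^+ 2).
Proof.
have : 0 <= \sum_i \sum_j (a i * b j - a j * b i) ^+ 2.
  by apply: sumr_ge0 => i _; apply: sumr_ge0 => j _; exact: sqr_ge0.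
have -> : \sum_i \sum_j (a i * b j - a j * b i) ^+ 2 =
    \sum_i \sum_j (a i ^+ 2 * b j ^+ 2) + \sum_i \sum_j (b i ^+ 2 * a j ^+ 2)
    - 2 * \sum_i \sum_j ((a i * b i) * (a j * b j)).
  rewrite mulr_sumr -sumrN -!big_split; apply: eq_bigr => i _ /=.
  by rewrite mulr_sumr -sumrN -!big_split; apply: eq_bigr => j _ /=; ring.
rewrite -!big_distrlr /= expr2 => h; lra.
Qed.

Definition enorm v : R := Num.sqrt (\sum_(i < n) v ord0 i ^+ 2).

Lemma edistE x y : edist x y = enorm (x - y).
Proof. by congr Num.sqrt; apply: eq_bigr => i _; rewrite !mxE. Qed.

Lemma enorm_ge0 v : 0 <= enorm v. Proof. exact: sqrtr_ge0. Qed.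

Lemma enormZ (t : R) v : enorm (t *: v) = `|t| * enorm v.
Proof.
rewrite /enorm -sqrtr_sqr -sqrtrM ?sqr_ge0// mulr_sumr; congr Num.sqrt.
by apply: eq_bigr => i _; rewrite mxE exprMn.
Qed.

Lemma enormN v : enorm (- v) = enorm v.
Proof. by rewrite -scaleN1r enormZ normrN normr1 mul1r. Qed.

Lemma enorm0 : enorm 0 = 0.
Proof. by rewrite -(scale0r 0) enormZ normr0 mul0r. Qed.

Lemma enormD u v : enorm (u + v) <= enorm u + enorm v.
Proof.
have s0 w : 0 <= \sum_(i < n) w ord0 i ^+ 2 :> R.
  by apply: sumr_ge0 => i _; exact: sqr_ge0.
rewrite -(ler_pXn2r (ltn0Sn 1)) ?nnegrE ?addr_ge0 ?enorm_ge0//.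
rewrite sqrrD !sqr_sqrtr ?s0//.
have -> : \sum_i (u + v) ord0 i ^+ 2 = \sum_i u ord0 i ^+ 2 +
    (\sum_i u ord0 i * v ord0 i) *+ 2 + \sum_i v ord0 i ^+ 2.
  rewrite -mulr_natl mulr_sumr -!big_split; apply: eq_bigr => i _ /=.
  by rewrite !mxE; ring.
rewrite lerD2r lerD2l lerMn2r /= (le_trans (ler_norm _))//.
by rewrite -sqrtr_sqr -sqrtrM ?s0// ler_wsqrtr// sum_mul_sqr_le.
Qed.

Lemma edistxx x : edist x x = 0.
Proof. by rewrite edistE subrr enorm0. Qed.

Lemma edistC x y : edist x y = edist y x.
Proof. by rewrite !edistE -enormN opprB. Qed.

Lemma edist_triangle z x y : edist x y <= edist x z + edist z y.
Proof.
by rewrite !edistE; apply: le_trans (enormD _ _); rewrite addrA subrK.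
Qed.

Lemma edist_ge0 x y : 0 <= edist x y. Proof. exact: sqrtr_ge0. Qed.

Lemma le_diam (A : set 'rV[R]_n) (d : R) : 0 <= d ->
  (forall x y, A x -> A y -> edist x y <= d) -> (diam A <= d%:E)%E.
Proof.
move=> d0 Ad; rewrite /diam ge_max lee_fin d0 /=; apply: ge_ereal_sup.
by move=> _ [x [y [Ax Ay ->]]]; rewrite lee_fin Ad.
Qed.

Lemma diam_ge0 (A : set 'rV[R]_n) : (0 <= diam A)%E.
Proof. by rewrite /diam le_max lexx. Qed.

Lemma diam_ecball (c : 'rV[R]_n) (r : R) : 0 <= r ->
  (diam (ecball c r) <= (2 * r)%:E)%E.
Proof.
move=> r0; apply: le_diam => [|x y]; first by rewrite mulr_ge0.
rewrite /ecball/= => cx cy; have := edist_triangle c x y.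
by rewrite (edistC x c); lra.
Qed.

End EuclideanDistance.

(** * Separated families, packing premeasures and packing dimension *)

Section PackingNumbers.
Context {R : realType} {n : nat}.
Local Notation V := 'rV[R]_n.
Implicit Types (A B E : set V) (x y : V) (d t u : R).

Definition separated d A (xs : seq V) : Prop :=
  {in xs, forall x, A x} /\ pairwise (fun x y => d < edist x y) xs.

(** A quantitative form of the upper box dimension being at most [u]. *)
Definition box_bound u A : Prop :=
  exists C : R, forall d xs, 0 < d <= 1 -> separated d A xs ->
    (size xs)%:R <= C * d `^ (- u).

Lemma separated_nil d A : separated d A [::].
Proof. by split. Qed.

Lemma separated_cons d A x xs : A x -> separated d A xs ->
  (forall y, y \in xs -> d < edist x y) -> separated d A (x :: xs).
Proof.
move=> Ax [Axs sxs] xd; split => [y|].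
  by rewrite inE => /orP[/eqP ->//|/Axs].
by rewrite pairwise_cons sxs andbT; apply/allP.
Qed.

Lemma box_bound_sub u A B : A `<=` B -> box_bound u B -> box_bound u A.
Proof.
move=> AB [C HC]; exists C => d xs d01 [xsA xsp]; apply: HC => //.
by split => // x /xsA /AB.
Qed.

Lemma box_bound_ge0 u A (C : R) :
  (forall d xs, 0 < d <= 1 -> separated d A xs ->
    (size xs)%:R <= C * d `^ (- u)) -> 0 <= C.
Proof.
move=> /(_ 1 [::]); rewrite powR1 mulr1; apply; last exact: separated_nil.
by rewrite ltr01 lexx.
Qed.

Lemma box_bound_le u t A : u <= t -> box_bound u A -> box_bound t A.
Proof.
move=> ut [C HC]; exists C => d xs d01 sxs; apply: le_trans (HC _ _ d01 sxs) _.
rewrite ler_wpM2l ?(box_bound_ge0 HC)//.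
by apply: ger_powR => //; rewrite lerN2.
Qed.

(** Sizes of separated families are bounded, so a largest one exists; a point of [A] farther than
    [d] from all its members could be added to it. *)
Lemma box_bound_net u A d : box_bound u A -> 0 < d <= 1 ->
  exists P, separated d A P /\
    forall x, A x -> exists2 p, p \in P & edist p x <= d.
Proof.
move=> [C HC] d01.
pose Q k := `[< exists2 P, separated d A P & size P = k >].
have Q0 : exists k, Q k.
  by exists 0%N; apply/asboolP; exists [::] => //; exact: separated_nil.
have Qub k : Q k -> (k <= Num.truncn (C * d `^ (- u)))%N.
  move=> /asboolP[P sP <-]; rewrite truncn_ge_nat; first exact: HC.
  by rewrite mulr_ge0 ?powR_ge0 ?(box_bound_ge0 HC).
case: (ex_maxnP Q0 Qub) => k /asboolP[P sP sk] kmax.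
exists P; split => // x Ax; apply: contrapT => nx.
have : Q k.+1.
  apply/asboolP; exists (x :: P); last by rewrite /= sk.
  apply: separated_cons => // y yP; rewrite ltNge; apply/negP => xy.
  by apply: nx; exists y => //; rewrite edistC.
by move/kmax; rewrite ltnn.
Qed.

Lemma packing_premeasure_at_ge0 t d E : (0 <= packing_premeasure_at t d E)%E.
Proof.
apply: ereal_sup_ubound; exists set0, (fun=> 0), (fun=> 0); split.
  by split => // i j [].
by rewrite esum_set0.
Qed.

Lemma packing_premeasure_ge0 t E : (0 <= packing_premeasure t E)%E.
Proof.
apply: le_ereal_inf_tmp => _ [d _ <-]; exact: packing_premeasure_at_ge0.
Qed.

(** The closed balls of radius [d / 2] around the points are disjoint because the separation is
    strict. *)
Lemma separated_packing t d e A xs : 0 < d -> d <= 2 * e -> separated d A xs ->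
  (((size xs)%:R * d `^ t)%:E <= packing_premeasure_at t e A)%E.
Proof.
move=> d0 de [xsA xsp]; apply: ereal_sup_ubound.
exists `I_(size xs), (nth 0 xs), (fun=> d / 2); split; last first.
  rewrite esum_fset//; last by move=> i _; rewrite lee_fin powR_ge0.
  rewrite -(fsbig_ord _ _ (fun=> ((2 * (d / 2)) `^ t)%:E)) sumEFin sumr_const.
  by rewrite card_ord mulr_natl mulrC divfK.
split=> [i /= ixs|].
  by split; [exact/xsA/mem_nth | lra].
move=> i j /= ixs jxs [z [iz jz]].
have disj k l : (k < l < size xs)%N ->
    ecball (nth 0 xs k) (d / 2) z -> ecball (nth 0 xs l) (d / 2) z -> False.
  move=> /andP[kl lxs] /= kz lz.
  have := (pairwiseP 0 xsp) k l (ltn_trans kl lxs) lxs kl.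
  rewrite /ecball/= in kz lz.
  apply/negP; rewrite -leNgt (le_trans (edist_triangle z _ _))//.
  by rewrite (edistC z); lra.
case: (ltngtP i j) => // ij.
- by case: (disj i j); rewrite ?ij.
- by case: (disj j i); rewrite ?ij.
Qed.

Lemma box_bound_packing_premeasure t A : 0 <= t ->
  (packing_premeasure t A < +oo)%E -> box_bound t A.
Proof.
move=> t0 /ereal_inf_lt[_ [e /= e0 <-] foo].
have := packing_premeasure_at_ge0 t e A.
case E : (packing_premeasure_at t e A) foo => [M| |]// _ M0.
rewrite lee_fin in M0.
pose e' := Num.min (2 * e) 1.
have e'0 : 0 < e' by rewrite lt_min ltr01 andbT mulr_gt0.
have hM d xs : 0 < d -> d <= 2 * e -> separated d A xs ->
    (size xs)%:R <= M * d `^ (- t).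
  move=> d0 de /(separated_packing t d0 de); rewrite E lee_fin powRN.
  by rewrite ler_pdivlMr ?powR_gt0.
have e't : 1 <= e' `^ (- t).
  rewrite -{1}(powRr0 e'); apply: ger_powR; last by rewrite oppr_le0.
  by rewrite e'0 ge_min lexx orbT.
(* [hM] covers [d <= e']. A family separated at a larger scale is also separated at [e'], and the
   second factor pays for this. *)
exists (M * e' `^ (- t)) => d xs /andP[d0 d1] sxs.
case: (leP d e') => de'.
  apply: le_trans (hM _ _ d0 _ sxs) _.
    by rewrite (le_trans de')// ge_min lexx.
  by rewrite ler_wpM2r ?powR_ge0// ler_peMr.
have sxs' : separated e' A xs.
  case: sxs => xsA xsp; split => //; apply: sub_pairwise xsp => x y.
  exact: lt_trans.
apply: le_trans (hM _ _ e'0 _ sxs') _; first by rewrite ge_min lexx.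
rewrite ler_peMr ?mulr_ge0 ?powR_ge0//.
by rewrite -{1}(powRr0 d); apply: ger_powR; rewrite ?d0// oppr_le0.
Qed.

Lemma dyadic_level (r : R) (m : nat) : 0 < r <= 2^-1 ^+ m ->
  exists l, 2^-1 ^+ (m + l).+1 < r <= 2^-1 ^+ (m + l).
Proof.
move=> /andP[r0 rm].
have ex : exists l, 2^-1 ^+ (m + l).+1 < r.
  exists (Num.truncn r^-1); set k := Num.truncn _.
  have rk : r^-1 < (2 ^+ (m + k).+1 : R).
    apply: lt_le_trans (truncnS_gt _) _; rewrite -natrX ler_nat -/k.
    apply: leq_trans (ltnW (ltn_expl k.+1 (ltnSn 1))) _.
    by rewrite leq_exp2l// ltnS leq_addl.
  by rewrite exprVn -(invrK r) ltf_pV2 ?posrE ?invr_gt0 ?exprn_gt0.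
case: (ex_minnP ex) => -[|l] hl lmin.
  by exists 0%N; rewrite hl addn0.
exists l.+1; rewrite hl /=.
rewrite leNgt; apply/negP; rewrite addnS => /lmin.
by rewrite ltnn.
Qed.

Lemma powRX (a t : R) k : 0 <= a -> (a ^+ k) `^ t = (a `^ t) ^+ k.
Proof.
by move=> a0; rewrite -!powR_mulrn ?powR_ge0// powRAC.
Qed.

(** Radii are sorted by dyadic range. Balls of one range have centres separated at its lower end,
    which bounds their number; range [k] then contributes at most a multiple of the [k]-th power of
    a ratio below 1. The geometric series starts at [m]. *)
Lemma packing_sum_le u t A (C : R) : 0 <= t -> u < t ->
  (forall d xs, 0 < d <= 1 -> separated d A xs ->
    (size xs)%:R <= C * d `^ (- u)) ->
  exists2 K : R, 0 <= K & forall m D c r, packing (2^-1 ^+ m) A D c r ->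
    (\esum_(i in D) ((2 * r i) `^ t)%:E
      <= (K * (2^-1 `^ (t - u)) ^+ m)%:E)%E.
Proof.
move=> t0 ut HC; have C0 := box_bound_ge0 HC.
pose h : R := 2^-1; have h0 : 0 < h by rewrite invr_gt0.
have h1 : h < 1 by rewrite invf_lt1// ltr1n.
pose q := h `^ (t - u).
have q0 : 0 < q by rewrite powR_gt0.
have q1 : q < 1.
  have -> : 1 = 1 `^ (t - u) :> R by rewrite powR1.
  by rewrite gt0_ltr_powR ?nnegrE ?subr_gt0// ltW.
(* The factor [h] to the power [- u] arises because balls of range [k] are counted at scale
   [h ^+ k.+1]. *)
pose K0 := C * h `^ (- u) * 2 `^ t.
have K00 : 0 <= K0 by rewrite !mulr_ge0 ?powR_ge0.
exists (K0 / (1 - q)); first by rewrite divr_ge0// subr_ge0 ltW.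
move=> m D c r [DA Dtriv].
have lev i : exists l, D i -> h ^+ (m + l).+1 < r i <= h ^+ (m + l).
  case: (pselect (D i)) => Di; last by exists 0%N.
  by have [l hl] := dyadic_level (DA i Di).2; exists l.
have {lev}[l hl] := choice lev.
(* It suffices to bound the finite partial sums. *)
apply: ge_ereal_sup => _ [X [finX XD] <-].
rewrite fsbig_finite//= sumEFin lee_fin.
have XDs i : i \in fset_set X -> D i.
  by rewrite in_fset_set// => /set_mem/XD.
have := fset_uniq (fset_set X).
have {}XDs : {in enum_fset (fset_set X), forall i, D i} by move=> i /XDs.
move: (enum_fset _) XDs => s sD us {X finX XD}.
have level M : \sum_(i <- s | l i == M) (2 * r i) `^ t <= K0 * q ^+ (m + M).
  set k := (m + M)%N.
  have hk0 : 0 <= h ^+ k by rewrite exprn_ge0// ltW.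
  have sep : separated (h ^+ k.+1) A [seq c i | i <- s & l i == M].
    split=> [x /mapP[i]|].
      by rewrite mem_filter => /andP[_ /sD Di] ->; exact: (DA i Di).1.
    rewrite pairwise_map.
    apply: (@sub_in_pairwise _ [in [seq i <- s | l i == M]]
      [rel i j | i != j]); last first.
    - by rewrite -uniq_pairwise filter_uniq.
    - exact/allP.
    move=> i j; rewrite !mem_filter.
    move=> /andP[/eqP li /sD Di] /andP[/eqP lj /sD Dj] /= ij.
    have /andP[+ _] := hl i Di; rewrite li -/k => hr.
    (* Otherwise [c j] would lie in both balls, against disjointness. *)
    apply: lt_trans hr _; rewrite ltNge; apply/negP => cij.
    move/eqP: ij; apply; apply: Dtriv => //.
    exists (c j); split => //; rewrite /ecball/= edistxx ltW//.
    by have /andP[] := (DA j Dj).2.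
  have hk01 : 0 < h ^+ k.+1 <= 1.
    by rewrite exprn_gt0//= exprn_ile1 ?(ltW h0) ?(ltW h1).
  have := HC _ _ hk01 sep; rewrite size_map => szle.
  apply: (@le_trans _ _ (\sum_(i <- s | l i == M) (2 * h ^+ k) `^ t)).
    rewrite big_seq_cond [leRHS]big_seq_cond; apply: ler_sum => i.
    move=> /andP[/sD Di /eqP li].
    have /andP[_ rk] := hl i Di; have /andP[ri0 _] := (DA i Di).2.
    rewrite ge0_ler_powR ?nnegrE ?mulr_ge0 ?ler_pM2l//; first exact: ltW.
    by rewrite li in rk.
  rewrite big_const_seq iter_addr addr0 -size_filter -[leLHS]mulr_natl.
  apply: le_trans (ler_wpM2r (powR_ge0 _ _) szle) _.
  rewrite powRM// !powRX ?(ltW h0)// exprS.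
  rewrite /K0 /q powRD; last by rewrite (gt_eqF h0) implybT.
  rewrite exprMn le_eqVlt; apply/orP; left; apply/eqP; ring.
have upto M : \sum_(i <- s | (l i < M)%N) (2 * r i) `^ t
    <= K0 * q ^+ m * ((1 - q ^+ M) / (1 - q)).
  elim: M => [|M IH]; first by rewrite big_pred0// expr0 subrr mul0r mulr0.
  rewrite (bigID (fun i => (l i < M)%N)) /=.
  have -> : (1 - q ^+ M.+1) / (1 - q) = (1 - q ^+ M) / (1 - q) + q ^+ M.
    by rewrite exprS; field; rewrite subr_eq0 gt_eqF.
  rewrite mulrDr lerD//.
    under eq_bigl => i.
      have -> : ((l i < M.+1) && (l i < M))%N = (l i < M)%N by lia.
    over.
    exact: IH.
  rewrite -mulrA -exprD.
  under eq_bigl => i.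
    have -> : ((l i < M.+1) && ~~ (l i < M))%N = (l i == M)%N by lia.
  over.
  exact: level.
have -> : \sum_(i <- s) (2 * r i) `^ t =
    \sum_(i <- s | (l i < (\max_(j <- s) l j).+1)%N) (2 * r i) `^ t.
  rewrite big_seq [RHS]big_seq_cond; apply: eq_bigl => i.
  by case si: (i \in s) => //=; rewrite ltnS leq_bigmax_seq.
clearbody K0; apply: le_trans (upto _) _; rewrite -/h -/q.
set N := (\max_(j <- s) l j).+1.
have -> : K0 * q ^+ m * ((1 - q ^+ N) / (1 - q)) =
    K0 / (1 - q) * q ^+ m * (1 - q ^+ N) by ring.
have q10 : 0 <= 1 - q by rewrite subr_ge0 ltW.
rewrite ler_piMr ?mulr_ge0 ?invr_ge0 ?exprn_ge0 ?(ltW q0)//.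
by rewrite lerBlDr lerDl exprn_ge0 ?(ltW q0).
Qed.

(** Packings with radii at most [2^-1 ^+ m] have sums tending to 0 as [m] grows. *)
Lemma packing_premeasure_eq0 u t A : 0 <= t -> u < t -> box_bound u A ->
  packing_premeasure t A = 0%E.
Proof.
move=> t0 ut [C HC].
have [K K0 hK] := packing_sum_le t0 ut HC.
apply/eqP; rewrite eq_le packing_premeasure_ge0 andbT.
apply/lee_addgt0Pr => e e0; rewrite add0e.
set q : R := 2^-1 `^ (t - u) in hK.
have q0 : 0 <= q by rewrite powR_ge0.
have q1 : q < 1.
  have -> : 1 = 1 `^ (t - u) :> R by rewrite powR1.
  by rewrite gt0_ltr_powR ?nnegrE ?subr_gt0// ?invf_lt1 ?ltr1n.
have [m hm] : exists m, K * q ^+ m <= e.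
  have : (fun m => K * q ^+ m) @ \oo --> (0 : R).
    rewrite -(mulr0 K); apply: cvgMr; apply: cvg_expr; rewrite ger0_norm//.
  move=> /cvgrPdist_le /(_ e e0)[m _ /(_ m (leqnn _))] /=.
  rewrite sub0r normrN ger0_norm ?mulr_ge0 ?exprn_ge0// => ?; by exists m.
apply: ge_ereal_inf; exists (packing_premeasure_at t (2^-1 ^+ m) A).
  by exists (2^-1 ^+ m) => //=; rewrite exprn_gt0 ?invr_gt0.
apply: ge_ereal_sup => _ [D [c [r [Dcr ->]]]].
by rewrite (le_trans (hK _ _ _ _ Dcr))// lee_fin.
Qed.

(** The family is turned into a sequence by pickling its indices; all its premeasures vanish at
    [t + e], for every [e > 0]. *)
Lemma dimP_le_cover (T : countType) (G : T -> set V) t E : 0 <= t ->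
  E `<=` \bigcup_k G k ->
  (forall k u, t < u -> packing_premeasure u (G k) = 0%E) ->
  (dimP E <= t%:E)%E.
Proof.
move=> t0 EG G0; apply/lee_addgt0Pr => e e0.
have te0 : 0 <= t + e by rewrite addr_ge0// ltW.
apply: ereal_inf_lbound; exists (t + e) => //; split => //.
apply/eqP; rewrite eq_le; apply/andP; split.
  apply: ereal_inf_lbound.
  exists (fun i => if choice.unpickle i is Some k then G k else set0); split.
    move=> x /EG[k _ Gx]; exists (choice.pickle k) => //=.
    by rewrite choice.pickleK.
  rewrite esum1// => i _; case: choice.unpickle => [k|].
    by rewrite G0// ltrDl.
  (* A code of no index gets the empty set, for which any exponent below [t + e] serves. *)
  apply: (@packing_premeasure_eq0 (t + e - 1)) => //.
    by rewrite ltrBlDr ltrDl.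
  exists 0 => d [|x xs] _; first by rewrite mul0r.
  by move=> [/(_ x (mem_head _ _))].
apply: le_ereal_inf_tmp => _ [A [_ ->]].
by apply: esum_ge0 => i _; exact: packing_premeasure_ge0.
Qed.

(** Some cover has total premeasure below 1, so each of its members has finite premeasure. *)
Lemma packing_measure0_cover t E : 0 <= t -> packing_measure t E = 0%E ->
  exists A : nat -> set V, E `<=` \bigcup_i A i /\ forall i, box_bound t (A i).
Proof.
move=> t0 E0.
have : (packing_measure t E < 1)%E by rewrite E0.
move=> /ereal_inf_lt[_ [A [EA ->]] A1]; exists A; split => // i.
apply: box_bound_packing_premeasure => //.
apply: le_lt_trans (lt_trans A1 (ltry 1)).
rewrite -(@esum_set1 _ _ i (fun i => packing_premeasure t (A i))).
  rewrite (esum_mkcond setT) (esum_mkcond [set i]); apply: le_esum => j _.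
  by rewrite in_setT; case: ifP => // _; exact: packing_premeasure_ge0.
exact: packing_premeasure_ge0.
Qed.

Lemma dimP_ge0 E : (0 <= dimP E)%E.
Proof. by apply: le_ereal_inf_tmp => _ [s [s0 _] <-]; rewrite lee_fin. Qed.

End PackingNumbers.

(** * Lower bounds on covering numbers from Hausdorff dimension *)

Section HausdorffPremeasure.
Context {R : realType} {n : nat}.
Local Notation V := 'rV[R]_n.
Implicit Types (S : set V) (p q : V) (s d rho tau c eta : R).

Lemma hausdorff_premeasure_ge0 s d S : (0 <= hausdorff_premeasure s d S)%E.
Proof.
apply: le_ereal_inf_tmp => _ [D [U [_ ->]]].
by apply: esum_ge0 => i _; exact: poweR_ge0.
Qed.

(** Covers of the [A i] of cost at most [e / 2 ^ i.+1] are merged into one, indexed by codes of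
    pairs. *)
Lemma hausdorff_premeasure_bigcup0 s d S (A : nat -> set V) :
  S `<=` \bigcup_i A i -> (forall i, hausdorff_premeasure s d (A i) = 0%E) ->
  hausdorff_premeasure s d S = 0%E.
Proof.
move=> SA A0; apply/eqP; rewrite eq_le hausdorff_premeasure_ge0 andbT.
apply/lee_addgt0Pr => e e0; rewrite add0e.
have cov i : exists DU : set nat * (nat -> set V),
    hausdorff_cover d (A i) DU.1 DU.2 /\
    (\esum_(k in DU.1) poweR (diam (DU.2 k)) s <= (e / (2 ^ i.+1)%:R)%:E)%E.
  have : (hausdorff_premeasure s d (A i) < (e / (2 ^ i.+1)%:R)%:E)%E.
    by rewrite A0 lte_fin divr_gt0// ltr0n expn_gt0.
  move=> /ereal_inf_lt[_ [D [U [DU ->]]]] /ltW le.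
  by exists (D, U).
have {cov}[F HF] := choice cov.
pose J := [set: nat] `*`` (fun i => (F i).1).
pose pk : nat * nat -> nat := choice.pickle.
pose U k := if (choice.unpickle k : option (nat * nat)) is Some ij
            then (F ij.1).2 ij.2 else set0.
have Upk ij : U (pk ij) = (F ij.1).2 ij.2 by rewrite /U /pk choice.pickleK.
apply: (@le_trans _ _ (\esum_(k in pk @` J) poweR (diam (U k)) s)%E).
  apply: ereal_inf_lbound; exists (pk @` J), U; split => //; split.
    move=> x /SA[i _ Aix]; have [[+ _] _] := HF i => /(_ x Aix)[k Dk Ukx].
    by exists (pk (i, k)); [exists (i, k) | rewrite Upk].
  move=> _ [[i k] [_ /= Dk] <-]; rewrite Upk.
  by have [[_ +] _] := HF i; exact.
rewrite (reindex_esum J (pk @` J) pk); last first.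
  split; [by move=> x Jx; exists x | | by []].
  by move=> x y _ _; exact: (pcan_inj choice.pickleK).
under eq_esum do rewrite Upk.
rewrite -(@esum_esum _ _ _ setT (fun i => (F i).1)
  (fun i k => poweR (diam ((F i).2 k)) s)); last first.
  by move=> *; exact: poweR_ge0.
apply: (@le_trans _ _ (\esum_(i in [set: nat]) (e / (2 ^ i.+1)%:R)%:E)%E).
  by apply: le_esum => i _; exact: (HF i).2.
rewrite -nneseries_esumT; last first.
  by move=> i; rewrite lee_fin divr_ge0// ltW.
exact: epsilon_trick0 (ltW e0).
Qed.

Lemma hausdorff_premeasure_balls s d S p r0 (qs : seq V) rho : 0 <= s ->
  0 <= r0 -> 2 * r0 <= d -> 0 <= rho -> 2 * rho <= d ->
  (forall x, S x -> ecball p r0 x \/ exists2 q, q \in qs & ecball q rho x) ->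
  (hausdorff_premeasure s d S
    <= ((2 * r0) `^ s + (size qs)%:R * (2 * rho) `^ s)%:E)%E.
Proof.
move=> s0 r00 r0d rho0 rhod cov.
have pow (c : V) (r : R) : 0 <= r ->
    (poweR (diam (ecball c r)) s <= ((2 * r) `^ s)%:E)%E.
  move=> r0'; rewrite -poweR_EFin; apply: gt0_ler_poweR => //.
  - by rewrite in_itv/= diam_ge0 leey.
  - by rewrite in_itv/= leey lee_fin mulr_ge0.
  - exact: diam_ecball.
(* Index 0 is the exceptional ball; the members of [qs] are shifted by one. *)
pose U i := if i is j.+1 then ecball (nth 0 qs j) rho else ecball p r0.
apply: (@le_trans _ _ (\esum_(i in `I_(size qs).+1) poweR (diam (U i)) s)%E).
  apply: ereal_inf_lbound; exists `I_(size qs).+1, U; split => //; split.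
    move=> x /cov[px|[q qqs qx]]; first by exists 0%N.
    exists (index q qs).+1; first by rewrite /= ltnS index_mem.
    by rewrite /= nth_index.
  by move=> [_|i _] /=; apply: le_trans (diam_ecball _ _) _; rewrite ?lee_fin.
rewrite esum_fset//; last by move=> i _; exact: poweR_ge0.
rewrite -(fsbig_ord _ _ (fun i => poweR (diam (U i)) s)) big_ord_recl /=.
rewrite EFinD [leLHS](_ : _ = (poweR (diam (ecball p r0)) s +
  \sum_(i < size qs) poweR (diam (ecball (nth 0%R qs i) rho)) s)%E)//.
apply: leeD; first exact: pow.
apply: (@le_trans _ _ (\sum_(i < size qs) ((2 * rho) `^ s)%:E)%E).
  by apply: lee_sum => i _; exact: pow.
by rewrite sumEFin sumr_const card_ord [(size qs)%:R * _]mulr_natl.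
Qed.

(* A scale-free lower bound on covering numbers that survives the removal of a
   ball, so that points of [S] can be chosen far apart. *)
Definition spread tau c eta S : Prop :=
  forall rho p (qs : seq V), 0 < rho <= eta ->
    (forall x, S x ->
      ecball p (2 * eta) x \/ exists2 q, q \in qs & ecball q rho x) ->
    c <= (size qs)%:R * rho `^ tau.

Lemma spread_sub tau c eta S S' : S `<=` S' -> spread tau c eta S ->
  spread tau c eta S'.
Proof.
by move=> SS' HS rho p qs rhoeta cov; apply: HS rhoeta _ => x /SS'; exact: cov.
Qed.

(** As [tau] is below the dimension, some premeasure of [S], hence of some [A i] inside [S], is
    positive. If the removed ball costs at most half of it, the other balls pay the rest. Both
    constants are taken of the form [k.+1%:R^-1] so that only countably many cases arise. *)
Lemma dimH1_spread tau S (A : nat -> set V) : 0 < tau < 1 -> dimH S = 1%E ->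
  S `<=` \bigcup_i A i ->
  exists i k, spread tau k.+1%:R^-1 k.+1%:R^-1 (A i `&` S).
Proof.
move=> /andP[tau0 tau1] S1 SA.
have [d d0 Hd] : exists2 d : R, 0 < d & hausdorff_premeasure tau d S <> 0%E.
  apply: contrapT => nex.
  have : (dimH S <= tau%:E)%E.
    apply: ereal_inf_lbound; exists tau => //; split; first exact: ltW.
    apply/eqP; rewrite eq_le; apply/andP; split.
      apply: ge_ereal_sup => _ [d d0 <-]; apply: contrapT => Hd.
      by apply: nex; exists d => // H0; apply: Hd; rewrite H0.
    apply: le_ereal_sup_tmp; exists (hausdorff_premeasure tau 1 S).
      by exists 1 => //=; exact: ltr01.
    exact: hausdorff_premeasure_ge0.
  by rewrite S1 lee_fin leNgt tau1.
have [i Hi] : exists i, hausdorff_premeasure tau d (A i `&` S) <> 0%E.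
  apply: contrapT => nex; apply: Hd.
  apply: (@hausdorff_premeasure_bigcup0 _ _ _ (fun i => A i `&` S)).
  - by move=> x Sx; have [i _ Aix] := SA x Sx; exists i.
  - by move=> i; apply: contrapT => Hi; apply: nex; exists i.
have [c0 c00 c0H] : exists2 c0 : R, 0 < c0 &
    (c0%:E <= hausdorff_premeasure tau d (A i `&` S))%E.
  have := hausdorff_premeasure_ge0 tau d (A i `&` S).
  move: Hi; case: hausdorff_premeasure => [c| |]// c0 cge0.
  - exists c => //; rewrite lt_neqAle -lee_fin cge0 andbT.
    by apply/eqP => c0'; apply: c0; rewrite -c0'.
  - by exists 1 => //; rewrite leey.
(* In order: the final lower bound; the ball of radius [2 * eta] has diameter at most [d]; it costs
   at most [c0 / 2]. *)
pose m := Num.min (c0 / 4) (Num.min (d / 4) ((c0 / 2) `^ tau^-1 / 4)).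
have m0 : 0 < m by rewrite !lt_min !divr_gt0// powR_gt0// divr_gt0.
exists i, (Num.truncn m^-1); set eta := _^-1.
have eta0 : 0 < eta by rewrite invr_gt0.
have : eta <= m.
  rewrite -(invrK m) lef_pV2 ?posrE ?invr_gt0//; exact/ltW/truncnS_gt.
rewrite !le_min => /and3P[etac etad etap].
move=> rho p qs /andP[rho0 rhoeta] cov.
have tau_ge0 := ltW tau0.
have := le_trans c0H (hausdorff_premeasure_balls tau_ge0 _ _ _ _ cov).
have -> : 0 <= 2 * eta by lra.
have -> : 2 * (2 * eta) <= d by lra.
rewrite (ltW rho0); have -> : 2 * rho <= d by lra.
move=> /(_ isT isT isT isT); rewrite lee_fin.
have h1 : (2 * (2 * eta)) `^ tau <= c0 / 2.
  have -> : c0 / 2 = ((c0 / 2) `^ tau^-1) `^ tau.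
    by rewrite -powRrM mulVf ?gt_eqF// powRr1// divr_ge0// ltW.
  by rewrite ge0_ler_powR// ?nnegrE ?powR_ge0//; lra.
have h2 : (2 * rho) `^ tau <= 2 * rho `^ tau.
  rewrite powRM ?(ltW rho0)// ler_wpM2r ?powR_ge0//.
  by rewrite ler1_powR ?ler1n// ltW.
have h3 := ler_wpM2l (ler0n R (size qs)) h2.
move: h3; rewrite mulrCA; lra.
Qed.

End HausdorffPremeasure.

(** * Incidences between points and pairs of net points *)

Section Incidences.
Context {R : realType} {n : nat}.
Local Notation V := 'rV[R]_n.
Implicit Types (A L X : set V) (x p q : V) (s d m rho tau c eta : R).

Lemma line_through L p q x : is_line L -> L p -> L q -> L x -> p != q ->
  exists t : R, x = p + t *: (q - p).
Proof.
move=> [a [v [v0 ->]]] [r _ <-] [r' _ <-] [w _ <-] pq.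
have rr' : r' - r != 0.
  by apply: contra pq; rewrite subr_eq0 => /eqP ->.
exists ((w - r) / (r' - r)).
rewrite opprD addrACA subrr add0r -scalerBl scalerA divfK// -addrA -scalerDl.
by congr (_ + _ *: _); ring.
Qed.

(** [p] and [q] will be net points, which can be counted; they stand in for the points [p'] and [q']
    of [A]. *)
Definition aligned A eta rho x p q : Prop :=
  eta < edist p q /\ exists p' q' (t : R),
    [/\ A p', A q', edist p p' <= rho, edist q q' <= rho
      & x = p' + t *: (q' - p')].

(** The points [p'] and [q'] are at least [eta / 2] apart while [x - p'] has norm at most [2 * m],
    which bounds [t]. Passing to [p] and [q] then costs at most [rho] times the sum of the absolute
    values of [1 - t] and [t]. *)
Lemma aligned_near_line A m eta rho x p q : 0 < eta -> rho <= eta / 4 ->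
  (forall y, A y -> enorm y <= m) -> enorm x <= m -> aligned A eta rho x p q ->
  exists t : R, `|t| <= 4 * m / eta /\
    enorm (x - (p + t *: (q - p))) <= (1 + 2 * (4 * m / eta)) * rho.
Proof.
move=> eta0 rhoeta Am xm [pq [p' [q' [t [Ap' Aq' pp' qq' xE]]]]]; subst x.
have p'q' : eta / 2 <= enorm (q' - p').
  rewrite -edistE; have := edist_triangle p' p q.
  have := edist_triangle q' p' q.
  by rewrite (edistC q' p') (edistC q' q); lra.
have tT : `|t| <= 4 * m / eta.
  rewrite ler_pdivlMr//.
  have : `|t| * enorm (q' - p') <= 2 * m.
    rewrite -enormZ -[t *: _](addKr p') (le_trans (enormD _ _))// enormN.
    by have := Am _ Ap'; lra.
  have := ler_wpM2l (normr_ge0 t) p'q'; lra.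
exists t; split => //.
have -> : p' + t *: (q' - p') - (p + t *: (q - p)) =
    (1 - t) *: (p' - p) + t *: (q' - q).
  by apply/rowP => i; rewrite !mxE; ring.
rewrite (le_trans (enormD _ _))// !enormZ -!edistE (edistC p') (edistC q').
have t1 : `|1 - t| <= 1 + `|t| by rewrite (le_trans (ler_normB _ _))// normr1.
have rho0 : 0 <= rho by apply: le_trans pp'; exact: edist_ge0.
have := ler_pM (normr_ge0 _) (edist_ge0 p p') t1 pp'.
have := ler_wpM2l (normr_ge0 t) qq'.
have := ler_wpM2r rho0 tT.
lra.
Qed.

(** The range of the parameter along [p q] is cut into intervals of length [rho]. Two points in one
    interval differ by at most two errors from [aligned_near_line] plus [2 * m * rho], hence by at
    most [d]; so each interval serves at most one point. *)
Lemma aligned_count A m d eta rho p q xs : 0 < eta -> 0 < rho <= 1 ->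
  rho <= eta / 4 -> (2 + 4 * (4 * m / eta) + 2 * m) * rho <= d ->
  (forall y, A y -> enorm y <= m) -> A p -> A q ->
  {in xs, forall x, enorm x <= m /\ aligned A eta rho x p q} ->
  pairwise (fun x y => d < edist x y) xs ->
  (size xs)%:R <= (2 * (4 * m / eta) + 1) / rho.
Proof.
move=> eta0 /andP[rho0 rho1] rhoeta Kd Am Ap Aq xsP xsd.
set T := 4 * m / eta in Kd *.
have m0 : 0 <= m by apply: le_trans (enorm_ge0 p) (Am _ Ap).
have T0 : 0 <= T by rewrite divr_ge0 ?mulr_ge0// ltW.
have ex x : exists t : R, x \in xs -> `|t| <= T /\
    enorm (x - (p + t *: (q - p))) <= (1 + 2 * T) * rho.
  case: (boolP (x \in xs)) => [xin|_]; last by exists 0.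
  have [xm al] := xsP x xin.
  by have [t ht] := aligned_near_line eta0 rhoeta Am xm al; exists t.
have [t ht] := choice ex.
pose f x := Num.truncn ((t x + T) / rho).
have pos x : x \in xs -> 0 <= (t x + T) / rho.
  move=> /ht[+ _]; rewrite ler_norml => /andP[? _].
  by rewrite divr_ge0 ?(ltW rho0)//; lra.
have close x y : x \in xs -> y \in xs -> f x = f y -> edist x y <= d.
  move=> xin yin fxy.
  have /andP[lx ux] := truncn_itv (pos x xin).
  have /andP[ly uy] := truncn_itv (pos y yin).
  rewrite -/(f x) fxy in lx ux; rewrite -/(f y) in ly uy.
  have txy : `|t x - t y| <= rho.
    rewrite ler_norml; move: lx ux ly uy; rewrite -natr1.
    rewrite !ler_pdivlMr// !ltr_pdivrMr// mulrDl mul1r => *.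
    by apply/andP; split; lra.
  have [_ hx] := ht x xin; have [_ hy] := ht y yin.
  have pq : enorm (q - p) <= 2 * m.
    rewrite (le_trans (enormD _ _))// enormN.
    by have := Am _ Ap; have := Am _ Aq; lra.
  rewrite edistE.
  have -> : x - y = (x - (p + t x *: (q - p))) - (y - (p + t y *: (q - p))) +
      (t x - t y) *: (q - p).
    by apply/rowP => i; rewrite !mxE; ring.
  rewrite (le_trans (enormD _ _))// enormZ.
  have := enormD (x - (p + t x *: (q - p))) (- (y - (p + t y *: (q - p)))).
  rewrite enormN.
  have := ler_pM (normr_ge0 _) (enorm_ge0 _) txy pq.
  lra.
have uf : uniq (map f xs).
  rewrite uniq_pairwise pairwise_map.
  apply: (@sub_in_pairwise _ [in xs] (fun x y => d < edist x y)) => //.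
  move=> x y xin yin /= dxy; apply/eqP => fxy.
  by have := close _ _ xin yin fxy; rewrite leNgt dxy.
have := uniq_leq_size uf (s2 := iota 0 (Num.truncn (2 * T / rho)).+1).
rewrite size_map size_iota => sz.
have : (size xs <= (Num.truncn (2 * T / rho)).+1)%N.
  apply: sz => _ /mapP[x xin ->]; rewrite mem_iota /= add0n ltnS.
  apply: le_truncn; rewrite ler_pM2r ?invr_gt0//.
  by have [+ _] := ht x xin; rewrite ler_norml => /andP[_ ?]; lra.
rewrite -(ler_nat R) => /le_trans; apply.
(* The last interval, counted by the successor, is absorbed in [rho^-1], as [rho <= 1]. *)
have -> : (2 * T + 1) / rho = 2 * T / rho + rho^-1 by rewrite mulrDl mul1r.
rewrite -natr1 lerD//.
  by rewrite truncn_le divr_ge0 ?(ltW rho0)// mulr_ge0.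
by rewrite invf_ge1.
Qed.

Lemma sumr_const_seq (I : Type) (r : seq I) (a : R) :
  \sum_(i <- r) a = a *+ size r.
Proof. by rewrite big_const_seq iter_addr addr0 count_predT. Qed.

(** [spread] is used twice: for the number of net points [p] near [L], then, with a ball around [p]
    removed, for the number of partners [q] far from [p]. *)
Lemma aligned_pairs A L tau c eta rho x (P : seq V) : 0 < c -> 0 < rho ->
  rho <= eta / 4 -> is_line L -> L x -> spread tau c eta (A `&` L) ->
  (forall y, A y -> exists2 p, p \in P & edist p y <= rho) ->
  (c / rho `^ tau) ^+ 2 <=
    \sum_(p <- P) \sum_(q <- P) (`[< aligned A eta rho x p q >] : nat)%:R.
Proof.
move=> c0 rho0 rhoeta lineL Lx Lspread net.
have rhoeta' : 0 < rho <= eta by rewrite rho0/=; lra.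
pose nearb p := `[< exists2 p', (A `&` L) p' & edist p p' <= rho >].
pose T := [seq p <- P | nearb p].
have netT y : (A `&` L) y -> exists2 q, q \in T & edist q y <= rho.
  move=> ALy; have [q qP qy] := net y ALy.1; exists q => //.
  by rewrite mem_filter qP andbT; apply/asboolP; exists y.
have k0 : 0 < rho `^ tau by rewrite powR_gt0.
have sizeT : c / rho `^ tau <= (size T)%:R.
  rewrite ler_pdivrMr//; apply: (Lspread rho 0 T rhoeta') => y /netT[q qT qy].
  by right; exists q.
have far p : c / rho `^ tau <= (size [seq q <- T | eta < edist p q])%:R.
  rewrite ler_pdivrMr//; apply: (Lspread rho p _ rhoeta') => y /netT[q qT qy].
  case: (ltP eta (edist p q)) => pq.
    by right; exists q => //; rewrite mem_filter pq.
  (* A net point within [eta] of [p] only covers points of the removed ball. *)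
  left; rewrite /ecball/=; have := edist_triangle q p y; lra.
apply: (@le_trans _ _ (\sum_(p <- T) c / rho `^ tau)).
  rewrite sumr_const_seq -mulr_natr expr2.
  by rewrite ler_wpM2l// divr_ge0// ltW.
rewrite big_filter big_mkcond /=; apply: ler_sum => p _.
case: ifPn => [/asboolP[p' [Ap' Lp'] pp']|_]; last first.
  by apply: sumr_ge0 => q _; rewrite ler0n.
apply: le_trans (far p) _.
rewrite size_filter -sum1_count natr_sum big_filter_cond big_mkcond /=.
apply: ler_sum => q _; case: ifPn => [/andP[/asboolP[q' [Aq' Lq'] qq'] pq]|_]//.
rewrite ler_nat lt0b; apply/asboolP; split => //.
have [|t xt] := line_through lineL Lp' Lq' Lx; last first.
  by exists p', q', t.
(* If they coincided, [p] and [q] would be within [2 * rho], less than [eta]. *)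
apply/eqP => p'q'; rewrite -p'q' in qq'.
have := edist_triangle p' p q; rewrite (edistC p' q).
by have := edist_ge0 p p'; lra.
Qed.

(** Double counting of the aligned triples of a point of [X] and two net points. *)
Lemma line_union_box_bound A X s tau m c eta : 0 < c -> 0 < eta ->
  box_bound s A -> (forall y, A y -> enorm y <= m) ->
  (forall x, X x -> enorm x <= m) ->
  (forall x, X x -> exists L,
    [/\ is_line L, L x & spread tau c eta (A `&` L)]) ->
  box_bound (2 * s + 1 - 2 * tau) X.
Proof.
move=> c0 eta0 As Am Xm XL.
have [m0|m0] := ltP m 0.
  exists 0 => d [|x xs] _; first by rewrite mul0r.
  move=> [/(_ x (mem_head _ _)) /Xm xm _].
  by have := le_lt_trans xm m0; rewrite ltNge enorm_ge0.
set T := 4 * m / eta.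
have T0 : 0 <= T by rewrite divr_ge0 ?mulr_ge0// ltW.
(* The ratio of [d] to [rho]: the first three terms are those of [aligned_count], and the last gives
   [rho <= eta / 4]. *)
pose K := 2 + 4 * T + 2 * m + 4 / eta.
have eta40 : 0 < 4 / eta by rewrite divr_gt0.
have K0 : 0 < K by rewrite /K; lra.
have [C HC] := As; have C0 := box_bound_ge0 HC.
set u := 2 * s + 1 - 2 * tau.
exists (C ^+ 2 * (2 * T + 1) / c ^+ 2 * (K^-1) `^ (- u)).
move=> d xs /andP[d0 d1] [xsX xsd].
pose rho := d / K; have rho0 : 0 < rho by rewrite divr_gt0.
have Krho : K * rho = d by rewrite mulrC divfK// gt_eqF.
have rho1 : rho <= 1.
  rewrite ler_pdivrMr// mul1r (le_trans d1)// /K; lra.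
have rhoeta : rho <= eta / 4.
  rewrite ler_pdivrMr// (le_trans d1)//.
  have eK : eta / 4 * (4 / eta) = 1 by field; rewrite gt_eqF.
  by rewrite -[leLHS]eK ler_pM2l ?divr_gt0// /K; lra.
have rho01 : 0 < rho <= 1 by rewrite rho0.
have [P [sepP netP]] := box_bound_net As rho01.
have szP := HC _ _ rho01 sepP.
have Kd : (2 + 4 * T + 2 * m) * rho <= d.
  by rewrite -[leRHS]Krho ler_pM2r// /K; lra.
have lower : (size xs)%:R * (c / rho `^ tau) ^+ 2 <=
    \sum_(x <- xs) \sum_(p <- P)
    \sum_(q <- P) (`[< aligned A eta rho x p q >] : nat)%:R.
  rewrite mulr_natl -sumr_const_seq.
  rewrite big_seq [leRHS]big_seq; apply: ler_sum => x /xsX /XL[L [lineL Lx HL]].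
  exact: aligned_pairs HL netP.
have upper : \sum_(x <- xs) \sum_(p <- P)
    \sum_(q <- P) (`[< aligned A eta rho x p q >] : nat)%:R
    <= (C * rho `^ (- s)) ^+ 2 * ((2 * T + 1) / rho).
  (* The sum over [x] becomes the innermost, so that [aligned_count] bounds it for each pair. *)
  rewrite exchange_big /=; under eq_bigr do rewrite exchange_big /=.
  have M0 : 0 <= (2 * T + 1) / rho by rewrite divr_ge0 ?(ltW rho0)//; lra.
  apply: (@le_trans _ _ (\sum_(p <- P) \sum_(q <- P) (2 * T + 1) / rho)).
    rewrite big_seq [leRHS]big_seq; apply: ler_sum => p /sepP.1 Ap.
    rewrite big_seq [leRHS]big_seq; apply: ler_sum => q /sepP.1 Aq.
    rewrite -natr_sum -big_mkcond /= sum1_count -size_filter.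
    apply: (@aligned_count A m d eta rho p q) => //.
      move=> x; rewrite mem_filter => /andP[/asboolP al /xsX /Xm xm].
      by split.
    exact: pairwise_filter.
  rewrite !sumr_const_seq -mulrnA -[leLHS]mulr_natl natrM -expr2.
  by rewrite ler_wpM2r// ler_pXn2r// nnegrE ?mulr_ge0 ?powR_ge0.
have := le_trans lower upper.
rewrite (expr_div_n c) (mulrA _ (c ^+ 2)) ler_pdivrMr ?exprn_gt0 ?powR_gt0//.
rewrite -ler_pdivlMr ?exprn_gt0// => /le_trans; apply.
have rneq0 : rho != 0 by rewrite gt_eqF.
have -> : C ^+ 2 * (2 * T + 1) / c ^+ 2 * K^-1 `^ (- u) * d `^ (- u) =
    C ^+ 2 * (2 * T + 1) / c ^+ 2 * rho `^ (- u).
  by rewrite /rho powRM ?invr_ge0 ?(ltW d0) ?(ltW K0)//; ring.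
have -> : - u = (- s) + (- s) + (-1) + tau + tau by rewrite /u; ring.
do 4 (rewrite powRD; last by rewrite rneq0 implybT).
rewrite powR_inv1 ?(ltW rho0)// le_eqVlt; apply/orP; left; apply/eqP; ring.
Qed.

(** The size of a [rho]-net is at least of order [rho^-tau] and at most of order [rho^-s]; small
    [rho] decides. *)
Lemma spread_box_bound_le A s tau c eta : 0 < c -> 0 < eta ->
  box_bound s A -> spread tau c eta A -> tau <= s.
Proof.
move=> c0 eta0 As HA; rewrite leNgt; apply/negP => st.
have [C HC] := As; have C0 := box_bound_ge0 HC.
have small rho : 0 < rho <= 1 -> rho <= eta -> c <= C * rho `^ (tau - s).
  move=> /[dup] rho01 /andP[rho0 rho1] rhoeta.
  have [P [sepP netP]] := box_bound_net As rho01.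
  have rhoeta' : 0 < rho <= eta by rewrite rho0.
  have cP := HA rho 0 P rhoeta' (fun x Ax => or_intror (netP x Ax)).
  rewrite (le_trans cP)// powRD; last by rewrite (gt_eqF rho0) implybT.
  by rewrite mulrCA [leRHS]mulrC ler_wpM2r ?powR_ge0// HC.
(* At [rho <= b] the bound in [small] falls below [c]; the [+ 1] allows for [C = 0]. *)
pose b := (c / (2 * (C + 1))) `^ (tau - s)^-1.
have b0 : 0 < b by rewrite powR_gt0// divr_gt0//; lra.
pose rho := Num.min b (Num.min 1 eta).
have rho0 : 0 < rho by rewrite !lt_min b0 ltr01.
have rhob : rho <= b by rewrite ge_min lexx.
have := small rho; rewrite rho0 !ge_min !lexx !orbT => /(_ isT isT).
have tau0 : 0 < tau - s by rewrite subr_gt0.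
have : rho `^ (tau - s) <= c / (2 * (C + 1)).
  have -> : c / (2 * (C + 1)) = b `^ (tau - s).
    rewrite -powRrM mulVf ?gt_eqF// powRr1// divr_ge0 ?(ltW c0)//; lra.
  by rewrite ge0_ler_powR ?nnegrE ?(ltW rho0) ?(ltW b0) ?(ltW tau0).
move=> /(ler_wpM2l C0) h /le_trans /(_ h).
rewrite mulrA ler_pdivlMr; last by lra.
by apply/negP; rewrite -ltNge; nra.
Qed.

End Incidences.

(** * Countable decomposition of the line extension *)

Section LineExtension.
Context {R : realType} {n : nat}.
Local Notation V := 'rV[R]_n.
Implicit Types (E L : set V) (s tau : R).

(** Each set of the cover is cut by the centred balls of integer radius. *)
Lemma packing_measure0_bounded_cover s E :
  0 <= s -> packing_measure s E = 0%E ->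
  exists A : nat -> set V, E `<=` \bigcup_i A i /\
    forall i, box_bound s (A i) /\ exists m, forall y, A i y -> enorm y <= m.
Proof.
move=> s0 /(packing_measure0_cover s0)[A [EA As]].
exists (fun k => if (choice.unpickle k : option (nat * nat)) is Some (i, m)
  then A i `&` [set y | enorm y <= m%:R] else set0).
split=> [x Ex|k].
  have [i _ Aix] := EA x Ex.
  exists (choice.pickle (i, (Num.truncn (enorm x)).+1)) => //=.
  by rewrite choice.pickleK; split => //=; exact/ltW/truncnS_gt.
case: choice.unpickle => [[i m]|]; split.
- by apply: box_bound_sub (As i) => x [].
- by exists m%:R => y [].
- by apply: box_bound_sub (As 0%N).
- by exists 0.
Qed.

Lemma dimP_line_extension_le s tau E : 0 <= s -> 0 < tau < 1 ->
  packing_measure s E = 0%E -> (exists L, dimH (E `&` L) = 1%E) ->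
  (dimP (line_extension E) <= (2 * s + 1 - 2 * tau)%:E)%E.
Proof.
move=> s0 tau01 /(packing_measure0_bounded_cover s0)[A [EA HA]] [L0 L01].
have inc k : 0 < k.+1%:R^-1 :> R by rewrite invr_gt0.
have spreadL L : dimH (E `&` L) = 1%E ->
    exists i k, spread tau k.+1%:R^-1 k.+1%:R^-1 (A i `&` L).
  move=> L1; have ELA : E `&` L `<=` \bigcup_i A i by move=> x [/EA].
  have [i [k]] := dimH1_spread tau01 L1 ELA.
  by exists i, k; apply: spread_sub p => x [? []].
(* With [tau < 1] this makes the final exponent nonnegative and at least [s], so that it also serves
   for the sets [A i]. *)
have ts : tau <= s.
  have [i [k]] := spreadL L0 L01.
  move=> /(spread_sub (@subIsetl _ _ _)) /(spread_box_bound_le _ _ (HA i).1).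
  exact.
pose G (j : nat + nat * nat * nat) : set V :=
  match j with
  | inl i => A i
  | inr (i, k, m) => [set x | enorm x <= m%:R /\
      exists L, [/\ is_line L, L x
        & spread tau k.+1%:R^-1 k.+1%:R^-1 (A i `&` L)]]
  end.
have t0 : 0 <= 2 * s + 1 - 2 * tau by lra.
apply: (dimP_le_cover (G := G)) => // [x|j u tu].
  move=> [/EA[i _ Aix]|[L [lineL /spreadL[i [k sp]]] Lx]].
    by exists (inl i).
  exists (inr (i, k, (Num.truncn (enorm x)).+1)) => //; split.
    exact/ltW/truncnS_gt.
  by exists L.
apply: packing_premeasure_eq0 (le_trans t0 (ltW tu)) tu _.
case: j => [i|[[i k] m]] /=.
  by apply: box_bound_le (HA i).1; lra.
have [As [m' Am]] := HA i.
apply: (@line_union_box_bound _ _ (A i) _ s tau (Num.max m' m%:R)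
  _ _ (inc k) (inc k) As) => [y /Am ym|y [ym _]|y []//].
- by rewrite le_max ym.
- by rewrite le_max ym orbT.
Qed.

End LineExtension.

Theorem proposition4 (R : realType) (n : nat) (E F : set 'rV[R]_n)
    (hF : F = line_extension E) :
  E = F \/ (dimP F <= 2%:E * dimP E - 1)%E.
Proof.
have [EF|EF] := pselect (E = F); [by left | right].
have [L L1] : exists L, dimH (E `&` L) = 1%E.
  apply: contrapT => nL; apply: EF; rewrite hF; apply/seteqP.
  split=> [x|x [//|[L [_ L1] _]]]; first by left.
  by case: nL; exists L.
(* If [dimP E] is infinite, so is the right-hand side. *)
have := dimP_ge0 E; case dE : (dimP E) => [d| |]// d0; last first.
  by rewrite gt0_muley ?lte_fin// leey.
apply/lee_addgt0Pr => e e0.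
have : (dimP E < (d + e / 4)%:E)%E by rewrite dE lte_fin ltrDl divr_gt0.
move=> /ereal_inf_lt[_ [s [s0 Es] <-]]; rewrite lte_fin => sd.
(* Both [s] and [tau] are within [e / 4] of their limits and enter with factor 2, for a total error
   [e]. The maximum keeps [tau] positive for large [e]. *)
pose tau := Num.max 2^-1 (1 - e / 4).
have tau01 : 0 < tau < 1.
  by rewrite lt_max gt_max invr_gt0 ltr0n/= invf_lt1 ?ltr1n//=; lra.
have tau1 : 1 - e / 4 <= tau by rewrite le_max lexx orbT.
rewrite hF (le_trans (dimP_line_extension_le s0 tau01 Es (ex_intro _ L L1)))//.
by rewrite -EFinM -EFinB -EFinD lee_fin; lra.
Qed.
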